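(* Let $A=(a_{ij})\in\mathbb{R}^{s\times s}$ and $b=(b_i)\in\mathbb{R}^{1\times s}$ be the coefficients of an $s$-stage Runge--Kutta method, let $p\ge 1$, and let $\Psi_{\mathrm{RK}}(\bullet)$ be its Runge--Kutta character. If for all non-planar rooted trees $\tau$ with $|\tau|\le p$ $$\langle\Psi_{\mathrm{RK}}(\bullet),\tau\rangle=\frac{1}{\tau!},$$ where $\langle\Psi_{\mathrm{RK}}(\bullet),\tau\rangle$ is given by the recursions \begin{align*} \langle\Psi_{\mathrm{RK}}(\bullet),\tau\rangle&=b\,\langle\mathbf{K},\tau\rangle_s,\\ \langle\mathbf{K},\bullet\rangle_s&=(1,1,\dots,1)^T\in\mathbb{R}^s,\\ \langle\mathbf{K},B^+(\tau_1\tau_2\cdots\tau_m)\rangle_s&=A\langle\mathbf{K},\tau_1\rangle_s\cdot A\langle\mathbf{K},\tau_2\rangle_s\cdots A\langle\mathbf{K},\tau_m\rangle_s \end{align*} ($\cdot$ being the componentwise product of vectors in $\mathbb{R}^s$), then the Runge--Kutta method has order $p$ in every pre-Lie algebra.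
   Context: A (left) pre-Lie algebra over $\mathbb{R}$ is a vector space $\mathcal{L}$ with a bilinear product $\triangleright$ such that $(x\triangleright y)\triangleright z-x\triangleright(y\triangleright z)=(y\triangleright x)\triangleright z-y\triangleright(x\triangleright z)$. It is a post-Lie algebra with zero bracket $[\cdot,\cdot]$, whose enveloping algebra is the symmetric algebra $\mathcal{S}(\mathcal{L})$ (commutative concatenation product, unit $\mathbf{1}$), with coproduct $\Delta$ the algebra morphism such that $\Delta(x)=x\otimes\mathbf{1}+\mathbf{1}\otimes x$ for $x\in\mathcal{L}$ (Sweedler notation $\Delta(A)=A_{(1)}\otimes A_{(2)}$). The product $\triangleright$ extends uniquely to $\mathcal{S}(\mathcal{L})$ by $\mathbf{1}\triangleright A=A$; $(xA)\triangleright y=x\triangleright(A\triangleright y)-(x\triangleright A)\triangleright y$ for $x,y\in\mathcal{L}$; $A\triangleright(BC)=(A_{(1)}\triangleright B)(A_{(2)}\triangleright C)$. Set $A*B=A_{(1)}(A_{(2)}\triangleright B)$, an associative product. Define $\exp(f)=\sum_{n\ge0}\frac1{n!}f^n$ with respect to the symmetric product, and $\exp^*(f)=\sum_{n\ge0}\frac1{n!}f^{*n}$ with respect to $*$, as formal series. The Runge--Kutta method applied to $f$ is $K_i=\exp\big(\sum_{j=1}^sa_{ij}K_j\big)\triangleright f$ for $i=1,\dots,s$, $\Psi_{\mathrm{RK}}(f)=\exp\big(\sum_{j=1}^sb_jK_j\big)$. When applied to $hf$ with $f\in\mathcal{L}$ and $h$ a formal parameter, the $K_i$ are the unique solution in $h\mathcal{L}[[h]]$.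 The method has order $p$ in $\mathcal{L}$ if $\Psi_{\mathrm{RK}}(hf)-\exp^*(hf)=\mathcal{O}(h^{p+1})$ for all $f\in\mathcal{L}$, as formal power series in $h$ with coefficients in $\mathcal{S}(\mathcal{L})$. Trees: $T$ is the set of non-planar rooted trees, $\bullet$ the one-node tree, $|\tau|$ the number of nodes of $\tau$, $F$ the set of forests (commutative words in $T$, with empty word $\mathbf{1}$), and $B^+(\tau_1\cdots\tau_m)$ is the tree obtained by joining the roots of $\tau_1,\dots,\tau_m$ to a new root. The tree factorial is $\tau!=|\tau|\,\tau_1!\cdots\tau_m!$ for $\tau=B^+(\tau_1\cdots\tau_m)$ (so $\bullet!=1$). The free pre-Lie algebra on one generator $\bullet$ is the span of $T$, with $\tau_1\triangleright\tau_2$ the sum over all nodes $v$ of $\tau_2$ of the tree obtained by attaching the root of $\tau_1$ to $v$; its symmetric algebra is the span of $F$. The Runge--Kutta character $\Psi_{\mathrm{RK}}(\bullet)$ is the result of applying the method to $f=\bullet$ in the completion consisting of all infinite linear combinations of forests, and $\mathbf{K}=(K_1,\dots,K_s)$ denotes the corresponding stages. The pairing between infinite series and forests is given by $\langle\omega,\omega'\rangle=\sigma(\omega)$ if $\omega=\omega'$ and $0$ otherwise for $\omega,\omega'\in F$, where $\sigma(\mathbf{1})=1$, $\sigma(t_1\cdots t_m)=\sigma(t_1)\cdots\sigma(t_m)\mu_1!\mu_2!\cdots$ for trees $t_i$ ($\mu_1,\mu_2,\dots$ being the multiplicities of the distinct trees among $t_1,\dots,t_m$), and $\sigma(B^+(\omega))=\sigma(\omega)$.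 Finally $\langle\mathbf{K},\tau\rangle_s=(\langle K_1,\tau\rangle,\dots,\langle K_s,\tau\rangle)^T\in\mathbb{R}^s$. *)

(* Defs.v *)
From HB Require Import structures.
From mathcomp Require Import all_boot all_order all_algebra finmap.
From mathcomp Require Import boolp classical_sets functions cardinality fsbigop.
From mathcomp Require Import reals.
From mathcomp Require Import monalg.

Set Implicit Arguments.
Unset Strict Implicit.
Unset Printing Implicit Defensive.

Import GRing.Theory Num.Theory.
Local Open Scope classical_set_scope.
Local Open Scope ring_scope.

Section PreLie.
Context (R : realType).

Definition prelie (L : lmodType R) (tri : {bilinear L -> L -> L}) : Prop :=
  forall x y z : L,
    tri (tri x y) z - tri x (tri y z) = tri (tri y x) z - tri y (tri x z).

(* The universal property of the symmetric algebra. *)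
Definition symmetric_algebra (L : lmodType R) (S : comAlgType R)
    (iota : {linear L -> S}) : Prop :=
  forall (C : comAlgType R) (g : {linear L -> C}),
    exists2 phi : {lrmorphism S -> C}, (forall x, phi (iota x) = g x) &
      forall psi : {lrmorphism S -> C},
        (forall x, psi (iota x) = g x) -> psi =1 phi.

(* An element of S (x) S is represented by a sequence [:: (a1, b1); ...],     *)
(* standing for a1 (x) b1 + ...; two sequences represent the same tensor iff  *)
(* no bilinear map separates them.                                            *)
Definition tensor_eq (S : lmodType R) (u v : seq (S * S)) : Prop :=
  forall (M : lmodType R) (beta : {bilinear S -> S -> M}),
    \sum_(x <- u) beta x.1 x.2 = \sum_(x <- v) beta x.1 x.2.

(* delta a is a Sweedler representative of the coproduct of a: the class of   *)
(* delta modulo tensor_eq is the algebra morphism S -> S (x) S sending        *)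
(* iota x to iota x (x) 1 + 1 (x) iota x.                                     *)
Record is_coproduct (L : lmodType R) (S : comAlgType R) (iota : L -> S)
    (delta : S -> seq (S * S)) : Prop := IsCoproduct {
  coprod_linear : forall (c : R) (a b : S),
    tensor_eq (delta (c *: a + b))
              ([seq (c *: x.1, x.2) | x <- delta a] ++ delta b);
  coprod_one : tensor_eq (delta 1) [:: (1, 1)];
  coprod_mul : forall a b : S,
    tensor_eq (delta (a * b))
              [seq (x.1 * y.1, x.2 * y.2) | x <- delta a, y <- delta b];
  coprod_iota : forall x : L,
    tensor_eq (delta (iota x)) [:: (iota x, 1); (1, iota x)]
}.

(* The coproduct of S = S(L), and the extension ext of tri from L to S.       *)
Record enveloping (L : lmodType R) (tri : {bilinear L -> L -> L})
    (S : comAlgType R) (iota : {linear L -> S}) := Enveloping {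
  coprod : S -> seq (S * S);
  ext : {bilinear S -> S -> S};
  coprodP : is_coproduct iota coprod;
  ext_iota : forall x y : L, ext (iota x) (iota y) = iota (tri x y);
  ext_one : forall a : S, ext 1 a = a;
  ext_mul_iota : forall (x y : L) (a : S),
    ext (iota x * a) (iota y)
    = ext (iota x) (ext a (iota y)) - ext (ext (iota x) a) (iota y);
  ext_mulr : forall a b c : S,
    ext a (b * c) = \sum_(u <- coprod a) ext u.1 b * ext u.2 c
}.

Definition star (L : lmodType R) (tri : {bilinear L -> L -> L})
    (S : comAlgType R) (iota : {linear L -> S}) (E : enveloping tri iota)
    (a b : S) : S :=
  \sum_(u <- coprod E a) u.1 * ext E u.2 b.

(* A formal series is the family of its coefficients.  The exponential is     *)
(* computed coefficientwise, each coefficient being a sum over n with finite  *)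
(* support as soon as f has no constant term (and 0 by convention when the    *)
(* support is infinite).                                                      *)
Definition formal_exp (I : Type) (M : lmodType R)
    (mul : (I -> M) -> (I -> M) -> I -> M) (one f : I -> M) : I -> M :=
  fun i => \sum_(n \in [set: nat]) (n`!%:R)^-1 *: iter n (mul f) one i.

(* The stages are the unique solution in D of the Runge-Kutta equations; when *)
(* it exists, xget returns it.                                                *)
Definition rk_stages (V : lmodType R) (exp : V -> V) (tri : V -> V -> V)
    (D : set V) (s : nat) (A : 'M[R]_s) (f : V) : 'I_s -> V :=
  xget (fun=> 0) [set K : 'I_s -> V | (forall i, D (K i)) /\
    forall i, K i = tri (exp (\sum_j A i j *: K j)) f].

Definition rk_map (V : lmodType R) (exp : V -> V) (tri : V -> V -> V)
    (D : set V) (s : nat) (A : 'M[R]_s) (b : 'rV[R]_s) (f : V) : V :=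
  exp (\sum_j b 0 j *: rk_stages exp tri D A f j).

(* Formal power series in h with coefficients in S, as functions nat -> S.    *)

Definition cauchy (S : lmodType R) (op : S -> S -> S) (u v : nat -> S)
    : nat -> S :=
  fun n => \sum_(i < n.+1) op (u i) (v (n - i)%N).

Definition hmonom (S : lmodType R) (k : nat) (a : S) : nat -> S :=
  fun n => if n == k then a else 0.

Definition bigOh (S : lmodType R) (k : nat) (u : nat -> S) : Prop :=
  forall n, (n < k)%N -> u n = 0.

Definition series_exp (S : comAlgType R) (op : S -> S -> S)
    : (nat -> S) -> nat -> S :=
  formal_exp (cauchy op) (hmonom 0 1).

(* h L[[h]] *)
Definition stage_series (L : lmodType R) (S : comAlgType R) (iota : L -> S)
    : set (nat -> S) :=
  [set u | bigOh 1 u /\ forall n, exists x, u n = iota x].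

Definition rk_series (L : lmodType R) (tri : {bilinear L -> L -> L})
    (S : comAlgType R) (iota : {linear L -> S}) (E : enveloping tri iota)
    (s : nat) (A : 'M[R]_s) (b : 'rV[R]_s) (f : nat -> S) : nat -> S :=
  rk_map (series_exp *%R) (cauchy (ext E)) (stage_series iota) A b f.

Definition rk_order (s : nat) (A : 'M[R]_s) (b : 'rV[R]_s) (p : nat)
    (L : lmodType R) (tri : {bilinear L -> L -> L}) : Prop :=
  forall (S : comAlgType R) (iota : {linear L -> S}) (E : enveloping tri iota),
    symmetric_algebra iota ->
    forall f : L, let hf := hmonom 1 (iota f) in
      bigOh p.+1 (rk_series E A b hf - series_exp (star E) hf).

End PreLie.

Inductive ptree : predArgType := PNode of seq ptree.

Section PTreeInd.
Context (P : ptree -> Prop)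
  (PH : forall s, foldr (fun t Q => P t /\ Q) True s -> P (PNode s)).
Fixpoint ptree_nested_ind (t : ptree) : P t :=
  let: PNode s := t in
  PH ((fix all_ind (l : seq ptree) : foldr (fun t Q => P t /\ Q) True l :=
    if l is x :: l' then conj (ptree_nested_ind x) (all_ind l') else I) s).
End PTreeInd.

Fixpoint ptree_encode (t : ptree) : GenTree.tree void :=
  let: PNode s := t in GenTree.Node 0 (map ptree_encode s).
Fixpoint ptree_decode (t : GenTree.tree void) : ptree :=
  if t is GenTree.Node _ s then PNode (map ptree_decode s) else PNode [::].
Lemma ptree_encodeK : cancel ptree_encode ptree_decode.
Proof.
elim/ptree_nested_ind => s IH /=; congr PNode; rewrite -map_comp.
by elim: s IH => //= x s IHs [-> /IHs ->].
Qed.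
HB.instance Definition _ := Countable.copy ptree (can_type ptree_encodeK).

Lemma ptree_seq_ind (P : ptree -> Prop) :
  (forall s, (forall t, t \in s -> P t) -> P (PNode s)) -> forall t, P t.
Proof.
move=> H; elim/ptree_nested_ind => s IH; apply: H => t.
by elim: s IH => //= x s IHs [Px /IHs IH]; rewrite inE => /orP[/eqP->|/IH].
Qed.

(* A non-planar tree is represented by the planar tree in which the children  *)
(* of every node are sorted for an arbitrary fixed total order.               *)

Definition ptree_le (t u : ptree) : bool := (choice.pickle t <= choice.pickle u)%N.

Lemma ptree_le_total : total ptree_le.
Proof. by move=> t u; exact: leq_total. Qed.
Lemma ptree_le_trans : transitive ptree_le.
Proof. by move=> t u v; exact: leq_trans. Qed.
Lemma ptree_le_anti : antisymmetric ptree_le.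
Proof.
by move=> t u tu; apply: (pcan_inj (@choice.pickleK ptree)); exact: anti_leq.
Qed.

Fixpoint ptree_canon (t : ptree) : ptree :=
  let: PNode s := t in PNode (sort ptree_le (map ptree_canon s)).

Lemma ptree_canonK t : ptree_canon (ptree_canon t) = ptree_canon t.
Proof.
elim/ptree_seq_ind: t => s IH /=; congr PNode.
set l := sort _ (map ptree_canon s); have -> : map ptree_canon l = l.
  apply: map_id_in => u; rewrite mem_sort => /mapP[v vs ->]; exact: IH.
exact: sorted_sort ptree_le_trans _ (sort_sorted ptree_le_total _).
Qed.

Lemma ptree_canon_nodeP s s' :
  reflect (ptree_canon (PNode s) = ptree_canon (PNode s'))
          (perm_eq (map ptree_canon s) (map ptree_canon s')).
Proof.
apply: (iffP idP) => [/(perm_sortP ptree_le_total ptree_le_trans ptree_le_anti)|].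
  by move=> /= ->.
by case=> /(perm_sortP ptree_le_total ptree_le_trans ptree_le_anti).
Qed.

Record tree : predArgType :=
  Tree { tree_val :> ptree; _ : ptree_canon tree_val == tree_val }.
HB.instance Definition _ := [isSub for tree_val].
HB.instance Definition _ := [Countable of tree by <:].

Definition mktree (t : ptree) : tree := Tree (introT eqP (ptree_canonK t)).

Notation forest := {cmonom tree}.

Definition forest_of (ts : seq tree) : forest := \big[mmul/mone]_(t <- ts) ucm t.

Definition seq_of_forest (w : forest) : seq tree :=
  flatten [seq nseq (w t) t | t <- finsupp w].

Definition Bplus (w : forest) : tree :=
  mktree (PNode [seq tree_val t | t <- seq_of_forest w]).

Definition bullet : tree := Bplus mone.

Fixpoint ptree_size (t : ptree) : nat :=
  let: PNode s := t in (sumn (map ptree_size s)).+1.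

Fixpoint ptree_fact (t : ptree) : nat :=
  let: PNode s := t in
  (ptree_size t * foldr muln 1 (map ptree_fact s))%N.

(* Multiplicities are counted for equality of planar trees, so that this is   *)
(* the symmetry factor sigma(t) on sorted trees only.                         *)
Fixpoint ptree_sym (t : ptree) : nat :=
  let: PNode s := t in
  (foldr muln 1 (map ptree_sym s) * \prod_(u <- undup s) (count_mem u s)`!)%N.

Definition tree_size (t : tree) : nat := ptree_size t.
Definition tree_fact (t : tree) : nat := ptree_fact t.
Definition tree_sym (t : tree) : nat := ptree_sym t.

Definition forest_sym (w : forest) : nat :=
  (\prod_(t <- finsupp w) (tree_sym t ^ w t * (w t)`!))%N.

(* One tree for each node v of t, obtained by attaching the root of u to v.   *)
Fixpoint ptree_grafts (u t : ptree) : seq ptree :=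
  let: PNode s := t in
  PNode (u :: s) ::
  map PNode ((fix below (l : seq ptree) : seq (seq ptree) :=
    if l is x :: l' then
      [seq y :: l' | y <- ptree_grafts u x] ++ [seq x :: m | m <- below l']
    else [::]) s).

Section MalgLift.
Context (R : realType) (K : choiceType) (V : lmodType R).
Implicit Types (F : K -> V) (g : {malg R[K]}).

(* The linear map sending << k >> to F k. *)
Definition malg_lift F g : V := \sum_(k <- msupp g) g@_k *: F k.

Lemma malg_liftEw F g (d : {fset K}) :
  (msupp g `<=` d)%fset -> malg_lift F g = \sum_(k <- d) g@_k *: F k.
Proof.
move=> le; rewrite /malg_lift (big_fset_incl _ le) // => k _ /mcoeff_outdom ->.
by rewrite scale0r.
Qed.

Lemma malg_lift_is_linear F : linear (malg_lift F).
Proof.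
move=> c g1 g2; pose d := (msupp (c *: g1 + g2) `|` msupp g1 `|` msupp g2)%fset.
rewrite !(@malg_liftEw F _ d); last 3 first.
- by rewrite fsubsetUr.
- by rewrite /d -fsetUA fsetUCA fsubsetUl.
- by rewrite /d -fsetUA fsubsetUl.
rewrite scaler_sumr -big_split /=; apply: eq_bigr => k _.
by rewrite mcoeffD mcoeffZ scalerDl scalerA.
Qed.
HB.instance Definition _ F :=
  GRing.isLinear.Build R {malg R[K]} V *:%R (malg_lift F) (malg_lift_is_linear F).

Lemma malg_liftU F k : malg_lift F << k >> = F k.
Proof. by rewrite (malg_liftEw F msuppU_le) big_seq_fset1 mcoeffUU scale1r. Qed.

Lemma malg_liftUz F c k : malg_lift F << c *g k >> = c *: F k.
Proof. by rewrite (malg_liftEw F msuppU_le) big_seq_fset1 mcoeffUU. Qed.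

Lemma malg_liftE (psi : {linear {malg R[K]} -> V}) x :
  psi x = malg_lift (fun k => psi << k >>) x.
Proof.
rewrite {1}[x]monalgE linear_sum; apply: eq_bigr => k _.
have -> : << x@_k *g k >> = x@_k *: (<< k >> : {malg R[K]}).
  apply/malgP => j; rewrite mcoeffZ !mcoeffU.
  by case: eqP; rewrite ?mulr1n ?mulr0n ?mulr1 ?mulr0.
by rewrite linearZ.
Qed.

End MalgLift.

Lemma forest_ind (P : forest -> Prop) :
  P mone -> (forall t w, P w -> P (mmul (ucm t) w)) -> forall w, P w.
Proof.
move=> P1 PM w; have [n] := ubnP (mdeg w); elim: n w => // n IH w.
have [->//|w1] := eqVneq w mone.
have [t tw] : exists t, w t != 0%N.
  apply: contrapT => H; move/negP: w1; apply; apply/cmP => t; rewrite cm1.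
  by apply/eqP; apply: contrapT => /negP wt; apply: H; exists t.
have -> : w = mmul (ucm t) (divcm w (ucm t)).
  apply/eqP/cmP => u; rewrite cmM divcmE cmU; case: eqP => [<-|_].
    by rewrite subnKC // lt0n.
  by rewrite add0n subn0.
rewrite mdegM mdegU ltnS => lt; apply: PM; exact: IH.
Qed.

Section FreePreLie.
Context (R : realType).

Definition graft (a b : {malg R[tree]}) : {malg R[tree]} :=
  malg_lift (fun t : tree => malg_lift (fun u : tree =>
    \sum_(v <- ptree_grafts t u) << mktree v >>) b) a.

Lemma graft_is_bilinear :
  bilinear_for ( *:%R : R -> {malg R[tree]} -> {malg R[tree]}) *:%R graft.
Proof.
split=> [b c a1 a2|a c b1 b2]; first exact: linearP.
rewrite /= /graft /malg_lift scaler_sumr -big_split /=.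
by apply: eq_bigr => t _; rewrite -!/(malg_lift _ _) linearP scalerDr !scalerA mulrC.
Qed.
HB.instance Definition _ :=
  bilinear_isBilinear.Build R _ _ _ *:%R *:%R graft graft_is_bilinear.

Definition forest_iota : {malg R[tree]} -> {malg R[forest]} :=
  malg_lift (fun t : tree => << ucm t >>).
HB.instance Definition _ := GRing.Linear.on forest_iota.

Lemma forest_symmetric_algebra : symmetric_algebra forest_iota.
Proof.
move=> C g.
pose h0 (w : forest) : C := \prod_(t <- finsupp w) g << t >> ^+ w t.
have h0E (d : {fset tree}) (w : forest) : (finsupp w `<=` d)%fset ->
    h0 w = \prod_(t <- d) g << t >> ^+ w t.
  move=> le; rewrite /h0 (big_fset_incl _ le) // => t _.
  by rewrite -cmE_eq0 => /eqP ->.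
have h1 : h0 mone = 1.
  by rewrite (@h0E fset0) ?big_seq_fset0 // mdom1.
have hM w1 w2 : h0 (mmul w1 w2) = h0 w1 * h0 w2.
  rewrite (@h0E (finsupp w1 `|` finsupp w2)%fset) ?mdomD //.
  rewrite (h0E _ _ (fsubsetUl _ (finsupp w2))).
  rewrite (h0E _ _ (fsubsetUr (finsupp w1) _)) -big_split /=.
  by apply: eq_bigr => t _; rewrite cmM exprD.
have hU t : h0 (ucm t) = g << t >>.
  by rewrite /h0 mdomU big_seq_fset1 cmUU.
have phiM : monoid_morphism (malg_lift h0).
  split=> [|x y]; first by rewrite malg_liftU.
  rewrite malgME (linear_sum (malg_lift h0)) /= [X in _ = X * _]/malg_lift mulr_suml.
  apply: eq_bigr => i _.
  rewrite (linear_sum (malg_lift h0)) /= [X in _ = _ * X]/malg_lift mulr_sumr.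
  apply: eq_bigr => j _.
  by rewrite malg_liftUz hM -scalerAl -scalerAr scalerA.
pose aM := GRing.isMonoidMorphism.Build _ _ _ phiM.
pose phi : {lrmorphism {malg R[forest]} -> C} := HB.pack (malg_lift h0) aM.
have iU t : forest_iota << t >> = << ucm t >> by rewrite /forest_iota malg_liftU.
exists phi => [x|psi psiE x].
  change ((phi \o forest_iota : {linear _ -> _}) x = g x).
  rewrite malg_liftE [RHS]malg_liftE; congr malg_lift.
  by apply: funext => t /=; rewrite iU malg_liftU hU.
rewrite malg_liftE /=; apply: eq_bigr => w _; congr (_ *: _).
elim/forest_ind: w => [|t w IH]; first by rewrite h1 (rmorph1 psi).
rewrite hM hU; have <- : psi << ucm t >> = g << t >>
  by rewrite -psiE; congr (psi _); rewrite -iU.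
rewrite -IH -(rmorphM psi); congr (psi _).
transitivity (<< 1 * 1 *g mmul (ucm t) w >> : {malg R[forest]}).
  by rewrite mulr1.
by rewrite -fgmulUU.
Qed.

(* The completion of the span of forests: all infinite linear combinations of *)
(* forests, as families of coefficients.                                      *)
Notation fseries := (forest -> R^o).

(* The extension to infinite combinations of a bilinear operation on the span *)
(* of forests that adds up the numbers of nodes: the sum giving the           *)
(* coefficient of w then has finite support.                                  *)
Definition completed (op : {malg R[forest]} -> {malg R[forest]} -> {malg R[forest]})
    (u v : fseries) : fseries :=
  fun w => \sum_(x \in [set: forest * forest])
    u x.1 * v x.2 * (op << x.1 >> << x.2 >>)@_w.

Definition fmonom (w : forest) : fseries := fun w' => (w' == w)%:R.

Definition forest_exp : fseries -> fseries :=
  formal_exp (completed *%R) (fmonom mone).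

Definition tree_series : set fseries :=
  [set u | forall w, u w != 0 -> exists t, w = ucm t].

Definition rk_character_stages (E : enveloping graft forest_iota)
    (s : nat) (A : 'M[R]_s) : 'I_s -> fseries :=
  rk_stages forest_exp (completed (ext E)) tree_series A (fmonom (ucm bullet)).

Definition rk_character (E : enveloping graft forest_iota)
    (s : nat) (A : 'M[R]_s) (b : 'rV[R]_s) : fseries :=
  rk_map forest_exp (completed (ext E)) tree_series A b (fmonom (ucm bullet)).

Definition forest_pairing (w w' : forest) : R :=
  if w == w' then (forest_sym w)%:R else 0.

Definition pairing (u : fseries) (w : forest) : R :=
  \sum_(w' \in [set: forest]) u w' * forest_pairing w' w.

Definition cmul (s : nat) (u v : 'cV[R]_s) : 'cV[R]_s := map2_mx *%R u v.

Definition stage_pairing (s : nat) (K : 'I_s -> fseries) (t : tree) : 'cV[R]_s :=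
  \col_i pairing (K i) (ucm t).

End FreePreLie.

(* Main.v *)
From HB Require Import structures.
Require Import Defs.
From mathcomp Require Import all_boot all_order all_algebra finmap.
From mathcomp Require Import boolp classical_sets functions fsbigop reals.
From mathcomp Require Import monalg.

Set Implicit Arguments.
Unset Strict Implicit.
Unset Printing Implicit Defensive.

Import GRing.Theory Num.Theory.
Local Open Scope ring_scope.

(** Let f be an element of a pre-Lie algebra L and G = exp(Y) for the symmetric
    product, where Y in h L[[h]] solves dY/dh = exp(Y) |> f, Y(0) = 0.  Then
    G = exp^*(hf).  Indeed Y also solves dY/dh = f + f |> Y ([left_flow]): the
    flow of f is transported onto itself.  As f |> _ is a derivation of the
    symmetric product, dG/dh = (f + f |> Y) G = f G + f |> G = f * G, which
    gives the powers of f for * one after the other ([star_series_exp]).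

    The stages K_i = exp(sum_j a_ij K_j) |> hf and the exact Y obey equations of
    the same shape, so all of them expand in trees in the same way
    ([stage_combination]): the coefficients of h^n are, for one common list of
    trees t with n nodes and of elements x of S(L), the sums of c(t) x, where
    only the weight c(t) depends on the series.  It is 1/t! for Y, and for the
    K_i it obeys the recursion of the theorem.  A linear relation between weights
    is thus a relation between series: if the weights of sum_i b_i K_i are 1/t!
    up to p nodes, then sum_i b_i K_i and Y agree up to h^p, and so do their
    exponentials ([rk_order_weights]).

    It remains to read the weights off the character.  A series of trees u has
    an exponential with coefficient prod_t u(t)^(w t)/(w t)! at the forest w
    ([forest_expE]), and w |> bullet = B+(w) in the algebra of trees
    ([ext_forest_bullet]).  The symmetry factors of the pairing cancel these
    factorials, and the equations of the stages become the recursion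
    ([stage_pairing_Bplus]). *)

(** * Formal power series with coefficients in a commutative algebra *)

Section Series.
Context (R : realType) (S : comAlgType R).
Implicit Types (u v w U V : nat -> S) (m n : nat).

Lemma addfE u v n : (u + v) n = u n + v n.
Proof. by []. Qed.

Lemma cauchy_poly N u v n : (n < N)%N ->
  cauchy *%R u v n = (\poly_(i < N) u i * \poly_(i < N) v i)`_n.
Proof.
move=> nN; rewrite coefM; apply: eq_bigr => i _; rewrite !coef_poly.
by rewrite (leq_ltn_trans (leq_ord i) nN) (leq_ltn_trans (leq_subr _ _) nN).
Qed.

Lemma cauchyC u v : cauchy *%R u v = cauchy *%R v u.
Proof. by apply/funext => n; rewrite !(@cauchy_poly n.+1) // mulrC. Qed.

Lemma cauchyA u v w :
  cauchy *%R u (cauchy *%R v w) = cauchy *%R (cauchy *%R u v) w.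
Proof.
apply/funext => n.
transitivity ((\poly_(i < n.+1) u i * \poly_(i < n.+1) v i
               * \poly_(i < n.+1) w i)`_n); last first.
  rewrite coefM; apply: eq_bigr => i _; rewrite coef_poly ltnS leq_subr.
  by rewrite (@cauchy_poly n.+1).
rewrite -mulrA coefM; apply: eq_bigr => i _; rewrite coef_poly ltn_ord.
by rewrite (@cauchy_poly n.+1) // ltnS leq_subr.
Qed.

Lemma cauchyDr u v w :
  cauchy *%R u (v + w) = cauchy *%R u v + cauchy *%R u w.
Proof.
apply/funext => n; rewrite addfE /cauchy -big_split /=.
by apply: eq_bigr => i _; rewrite mulrDr.
Qed.

Lemma cauchyMnr u v m : cauchy *%R u (v *+ m) = cauchy *%R u v *+ m.
Proof.
elim: m => [|m IH]; last by rewrite !mulrS cauchyDr IH.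
by apply/funext => n; rewrite !mulr0n; apply: big1 => i _; rewrite mulr0.
Qed.

Lemma cauchy_hmonom0 a u n : cauchy *%R (hmonom 0 a) u n = a * u n.
Proof.
rewrite /cauchy big_ord_recl subn0 big1 ?addr0 // => k _.
by rewrite mul0r.
Qed.

Definition spow u m := iter m (cauchy *%R u) (hmonom 0 1).

Lemma spowS u m : spow u m.+1 = cauchy *%R u (spow u m).
Proof. by []. Qed.

(** The series u is divisible by h, hence its m-th power by h^m: this is what
    makes the sum defining the exponential finite in each degree. *)
Lemma spow_gt u m n : u 0%N = 0 -> (n < m)%N -> spow u m n = 0.
Proof.
move=> u0; elim: m n => [|m IH] n //; rewrite ltnS => nm.
rewrite spowS; apply: big1 => -[[|i] iP] _ /=; first by rewrite u0 mul0r.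
by rewrite IH ?mulr0 // (leq_trans _ nm) // ltn_subrL; case: n iP {nm}.
Qed.

Lemma series_expE N u n : u 0%N = 0 -> (n < N)%N ->
  series_exp *%R u n = \sum_(m < N) (m`!%:R)^-1 *: spow u m n.
Proof.
move=> u0 nN; rewrite /series_exp /formal_exp -/(spow u _).
rewrite (fsbigTE [fset m in iota 0 N]%fset); last first.
  move=> m; rewrite in_fset /= mem_iota /= add0n -leqNgt => Nm.
  by rewrite -/(spow u m) spow_gt ?scaler0 // (leq_trans nN Nm).
rewrite big_imfset //= undup_id ?iota_uniq //.
by rewrite -[N in LHS]subn0 -/(index_iota 0 N) big_mkord.
Qed.

Lemma series_exp0 u : u 0%N = 0 -> series_exp *%R u 0%N = 1.
Proof.
by move=> u0; rewrite (@series_expE 1) // big_ord1 fact0 invr1 scale1r.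
Qed.

Lemma eq_spow u v m n : (forall k, (k <= n)%N -> u k = v k) ->
  spow u m n = spow v m n.
Proof.
elim: m n => [//|m IH] n uv; rewrite !spowS; apply: eq_bigr => i _.
rewrite uv ?leq_ord // IH // => k kn; apply: uv.
by rewrite (leq_trans kn) // leq_subr.
Qed.

Lemma eq_series_exp u v n : u 0%N = 0 -> (forall k, (k <= n)%N -> u k = v k) ->
  series_exp *%R u n = series_exp *%R v n.
Proof.
move=> u0 uv; rewrite !(@series_expE n.+1) // -?uv //.
by apply: eq_bigr => m _; rewrite (eq_spow _ uv).
Qed.

(** A family of additive maps delta_n acts coefficientwise on series; the
    Leibniz rule makes it a derivation for the product of series.  Two cases
    matter: h d/dh, where delta_n is multiplication by n, and the derivation
    f |> _ of the coefficients, where delta_n does not depend on n. *)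
Section Derivation.
Context (delta : nat -> {linear S -> S}).
Context (deltaM : forall i j a b,
  delta (i + j)%N (a * b) = delta i a * b + a * delta j b).

Definition dseries u : nat -> S := fun n => delta n (u n).

Lemma dseriesM u v :
  dseries (cauchy *%R u v) = cauchy *%R (dseries u) v + cauchy *%R u (dseries v).
Proof.
apply/funext => n; rewrite addfE /dseries /cauchy linear_sum.
rewrite -big_split /=; apply: eq_bigr => i _.
by rewrite -{1}(subnKC (leq_ord i)) deltaM.
Qed.

Lemma dseries1 : dseries (hmonom 0 1) = 0.
Proof.
apply/funext => -[|n]; rewrite /dseries /hmonom /= ?linear0 //.
have /eqP := deltaM 0 0 1 1; rewrite !mul1r mulr1 addn0.
by rewrite -subr_eq subrr eq_sym => /eqP.
Qed.

Lemma dseriesX u m :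
  dseries (spow u m.+1) = cauchy *%R (dseries u) (spow u m) *+ m.+1.
Proof.
elim: m => [|m IH]; rewrite spowS dseriesM.
  rewrite /spow /= dseries1 mulr1n; apply/funext => n.
  by rewrite addfE /cauchy [X in _ + X]big1 ?addr0 // => i _; rewrite mulr0.
rewrite IH cauchyMnr cauchyA (cauchyC u) -cauchyA -spowS.
by rewrite -[in LHS](mulr1n (cauchy _ _ _)) -mulrnDr.
Qed.

(** The chain rule d(exp u) = (du) exp u, from d(u^m) = m (du) u^(m-1). *)
Lemma dseries_exp u n : u 0%N = 0 ->
  delta n (series_exp *%R u n)
  = cauchy *%R (dseries u) (series_exp *%R u) n.
Proof.
move=> u0; rewrite (@series_expE n.+2) // linear_sum big_ord_recl /=.
have -> : delta n ((0`!%:R)^-1 *: spow u 0 n) = 0.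
  have d1 : delta n (spow u 0 n) = 0 by exact: (congr1 (@^~ n) dseries1).
  by rewrite linearZ /= d1 scaler0.
rewrite add0r [RHS](eq_bigr (fun i : 'I_n.+1 => \sum_(m < n.+1)
    (m`!%:R)^-1 *: (dseries u i * spow u m (n - i)%N))); last first.
  move=> i _; rewrite (@series_expE n.+1) // ?ltnS ?leq_subr // mulr_sumr.
  by apply: eq_bigr => m _; rewrite -scalerAr.
rewrite exchange_big; apply: eq_bigr => m _ /=.
have dX : delta n (spow u m.+1 n) = (cauchy *%R (dseries u) (spow u m) *+ m.+1) n.
  exact: (congr1 (@^~ n) (dseriesX u m)).
rewrite linearZ /= dX -scaler_sumr.
have -> : (cauchy *%R (dseries u) (spow u m) *+ m.+1) n
    = m.+1%:R *: cauchy *%R (dseries u) (spow u m) n.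
  by rewrite scaler_nat; elim: m.+1 => [|k IH] //; rewrite !mulrS -IH.
rewrite scalerA factS natrM invfM mulrAC mulVf ?mul1r //.
by rewrite pnatr_eq0.
Qed.

End Derivation.

Lemma euler_exp u n : u 0%N = 0 ->
  n%:R *: series_exp *%R u n
  = \sum_(k < n.+1) (k%:R *: u k) * series_exp *%R u (n - k)%N.
Proof.
move=> u0.
pose d k : {linear S -> S} := ( *:%R (k%:R : R)).
apply: (@dseries_exp d) => // i j a b.
by rewrite /d /= natrD scalerDl -scalerAl -scalerAr.
Qed.

End Series.

(** * The enveloping algebra of a pre-Lie algebra *)

Section Enveloping.
Context (R : realType) (L : lmodType R) (tri : {bilinear L -> L -> L}).
Context (S : comAlgType R) (iota : {linear L -> S}) (E : enveloping tri iota).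
Implicit Types (x y f : L) (a b c : S).

Definition mul_linear (g1 g2 : {linear S -> S}) a b : S := g1 a * g2 b.

Lemma mul_linear_is_bilinear g1 g2 :
  bilinear_for ( *:%R : R -> S -> S) *:%R (mul_linear g1 g2).
Proof.
split=> [b k a1 a2|a k b1 b2]; rewrite /= /mul_linear linearP.
  by rewrite mulrDl scalerAl.
by rewrite mulrDr scalerAr.
Qed.
HB.instance Definition _ g1 g2 :=
  bilinear_isBilinear.Build R S S S *:%R *:%R (mul_linear g1 g2)
    (mul_linear_is_bilinear g1 g2).

Lemma sum_coprod_iota (g1 g2 : {linear S -> S}) x :
  \sum_(u <- coprod E (iota x)) g1 u.1 * g2 u.2
  = g1 (iota x) * g2 1 + g1 1 * g2 (iota x).
Proof.
have := coprod_iota (coprodP E) x (mul_linear g1 g2).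
by rewrite !big_cons big_nil addr0.
Qed.

Lemma sum_coprod0 (g1 g2 : {linear S -> S}) :
  \sum_(u <- coprod E 0) g1 u.1 * g2 u.2 = 0.
Proof.
have := coprod_linear (coprodP E) 1 0 0 (mul_linear g1 g2).
rewrite scaler0 addr0 big_cat /= big_map /= => /eqP.
rewrite -subr_eq subrr eq_sym => /eqP eq0; rewrite -[RHS]eq0.
by apply: eq_bigr => u _; rewrite scale1r.
Qed.

Lemma ext_iotaM x a b :
  ext E (iota x) (a * b) = ext E (iota x) a * b + a * ext E (iota x) b.
Proof.
rewrite ext_mulr (sum_coprod_iota (applyr (ext E) a) (applyr (ext E) b)).
by rewrite /= !ext_one.
Qed.

Lemma ext_iota1 x : ext E (iota x) 1 = 0.
Proof.
have /eqP := ext_iotaM x 1 1; rewrite !mul1r mulr1.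
by rewrite -subr_eq subrr eq_sym => /eqP.
Qed.

Lemma star_iota x a : star E (iota x) a = iota x * a + ext E (iota x) a.
Proof.
rewrite /star (sum_coprod_iota idfun (applyr (ext E) a)) /=.
by rewrite ext_one mul1r.
Qed.

Lemma star0 a : star E 0 a = 0.
Proof. exact: (sum_coprod0 idfun (applyr (ext E) a)). Qed.

(** The filtration, by number of factors, of the subalgebra generated by L. *)
Inductive words : nat -> S -> Prop :=
| words_zero n : words n 0
| words_one n : words n 1
| words_cons n x a : words n a -> words n.+1 (iota x * a)
| words_add n a b : words n a -> words n b -> words n (a + b).

Lemma ext_iota_words n x a : words n a -> words n (ext E (iota x) a).
Proof.
elim=> {n a} [n|n|n y a aw IH|n a b _ IHa _ IHb].
- by rewrite linear0r; constructor.
- by rewrite ext_iota1; constructor.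
- rewrite ext_iotaM ext_iota.
  by apply: words_add; apply: words_cons.
- by rewrite linearDr; constructor.
Qed.

Definition acts_in_iota a := forall y, exists z, ext E a (iota y) = iota z.

Lemma acts_in_iotaD a b :
  acts_in_iota a -> acts_in_iota b -> acts_in_iota (a + b).
Proof.
move=> aP bP y; have [[z za] [t tb]] := (aP y, bP y).
by exists (z + t); rewrite linearDl /= za tb linearD.
Qed.

Lemma acts_in_iotaZ k a : acts_in_iota a -> acts_in_iota (k *: a).
Proof.
by move=> aP y; have [z za] := aP y; exists (k *: z); rewrite linearZl_LR za linearZ.
Qed.

Lemma acts_in_iota0 : acts_in_iota 0.
Proof. by move=> y; exists 0; rewrite linear0l linear0. Qed.

(** Products of elements of L map L to itself.  The identity
    (xA) |> y = x |> (A |> y) - (x |> A) |> y trades a product of n + 1 elements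
    for products of at most n elements, because x |> _ keeps the number of
    factors. *)
Lemma words_acts n a : words n a -> acts_in_iota a.
Proof.
elim/ltn_ind: n a => n IH a aw; elim: aw IH => {n a}.
- by move=> n _; exact: acts_in_iota0.
- by move=> n _ y; exists y; rewrite ext_one.
- move=> n x a aw _ IH y; have [z za] := IH n (ltnSn n) _ aw y.
  have [t ta] := IH n (ltnSn n) _ (ext_iota_words x aw) y.
  exists (tri x z - t).
  by rewrite ext_mul_iota za ta ext_iota linearB.
- move=> n a b _ IHa _ IHb IH; exact: acts_in_iotaD (IHa IH) (IHb IH).
Qed.

Lemma series_exp_acts (u : nat -> S) n : u 0%N = 0 ->
  (forall k, (k <= n)%N -> exists x, u k = iota x) ->
  acts_in_iota (series_exp *%R u n).
Proof.
move=> u0 uL; rewrite (@series_expE _ _ n.+1) //.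
apply: big_ind => [||m _]; [exact: acts_in_iota0|exact: acts_in_iotaD|].
apply/acts_in_iotaZ/(@words_acts m).
case: m => m /= _; elim: m n uL => [|k IH] n uL.
  by rewrite /spow /= /hmonom; case: eqP => _; constructor.
rewrite spowS; apply: (big_ind (words k.+1)) => [||i _].
- by constructor.
- by move=> a b; exact: words_add.
- have [x ->] := uL i (leq_ord i); apply/words_cons/IH => l ln.
  by apply: uL; rewrite (leq_trans ln) // leq_subr.
Qed.

(** * The exact flow *)

Section Flow.
Context (f : L) (Y : nat -> S).
Context (Y0 : Y 0%N = 0) (YS : forall n,
  n.+1%:R *: Y n.+1 = ext E (series_exp *%R Y n) (iota f)).
Local Notation G := (series_exp *%R Y).

Lemma flow_exp n : n.+1%:R *: G n.+1
  = \sum_(k < n.+1) ext E (G k) (iota f) * G (n - k)%N.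
Proof.
rewrite euler_exp // big_ord_recl Y0 scaler0 mul0r add0r.
by apply: eq_bigr => k _; rewrite YS.
Qed.

Lemma ext_exp n : ext E (iota f) (G n)
  = \sum_(k < n.+1) ext E (iota f) (Y k) * G (n - k)%N.
Proof.
pose d (_ : nat) : {linear S -> S} := ext E (iota f).
by apply: (@dseries_exp R S d) => // i j a b; exact: ext_iotaM.
Qed.

(** This is the coefficient of h^n in dY/dh = f + f |> Y.  The difference Z of
    f + f |> Y and exp(Y) |> f satisfies the linear equation
    dZ/dh = (Z exp(Y)) |> f, by the identity
    f |> (G |> f) = (f G + f |> G) |> f, and it starts at zero. *)
Lemma left_flow n :
  hmonom 0 (iota f) n + ext E (iota f) (Y n) = ext E (G n) (iota f).
Proof.
elim/ltn_ind: n => -[_|n IH].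
  by rewrite Y0 linear0r addr0 series_exp0 // ext_one.
rewrite /hmonom add0r; apply: (@scalerI _ _ n.+1%:R).
  by rewrite pnatr_eq0.
have -> : n.+1%:R *: ext E (G n.+1) (iota f)
    = ext E (n.+1%:R *: G n.+1) (iota f) by rewrite linearZl_LR.
rewrite -linearZr_LR /= YS.
have := ext_mul_iota E f f (G n); rewrite ext_exp => /eqP.
rewrite eq_sym subr_eq => /eqP ->; rewrite -linearDl /= flow_exp.
congr (ext E _ _).
rewrite [RHS](eq_bigr (fun k : 'I_n.+1 =>
    hmonom 0 (iota f) k * G (n - k)%N + ext E (iota f) (Y k) * G (n - k)%N)).
  by rewrite big_split /= -/(cauchy _ _ _ n) cauchy_hmonom0.
by move=> k _; rewrite -IH // mulrDl.
Qed.

(** Both right hand sides of the flow are used: dG/dh = (dY/dh) G is expanded by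
    the equation for f + f |> Y, whose product with G is f * G. *)
Lemma star_exp n : n.+1%:R *: G n.+1 = star E (iota f) (G n).
Proof.
rewrite flow_exp star_iota ext_exp.
rewrite [LHS](eq_bigr (fun k : 'I_n.+1 =>
    hmonom 0 (iota f) k * G (n - k)%N + ext E (iota f) (Y k) * G (n - k)%N)).
  by rewrite big_split /= -/(cauchy _ _ _ n) cauchy_hmonom0.
by move=> k _; rewrite -left_flow mulrDl.
Qed.

Lemma star_power m : iter m (cauchy (star E) (hmonom 1 (iota f))) (hmonom 0 1)
  = hmonom m (m`!%:R *: G m).
Proof.
elim: m => [|m IH].
  by rewrite fact0 scale1r series_exp0.
rewrite iterS IH; apply/funext => n; rewrite /cauchy.
case: n => [|n].
  by rewrite big_ord1 star0.
rewrite big_ord_recl star0 add0r big_ord_recl /= big1 => [|i _]; last first.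
  by rewrite {1}/hmonom /= star0.
rewrite addr0 {1}/hmonom /bump /= subSS subn0 /hmonom eqSS.
case: eqP => [_|_]; last by rewrite star_iota mulr0 linear0r addr0.
rewrite factS mulnC natrM -scalerA star_exp !star_iota.
by rewrite scalerDr -scalerAr linearZr_LR.
Qed.

Lemma star_series_exp :
  series_exp (star E) (hmonom 1 (iota f)) = series_exp *%R Y.
Proof.
apply/funext => n; rewrite {1}/series_exp /formal_exp.
rewrite (fsbigTE [fset n]%fset) => [|m]; rewrite ?big_seq_fset1 star_power.
  by rewrite /hmonom eqxx scalerA mulVf ?scale1r // pnatr_eq0 -lt0n fact_gt0.
by rewrite inE /hmonom eq_sym => /negPf ->; rewrite scaler0.
Qed.

End Flow.

End Enveloping.

(** * Runge-Kutta stages as series in h *)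

(** The n-th coefficients of the image depend on lower coefficients only, so
    iterating n + 1 times from anywhere determines the coefficients up to n. *)
Lemma causal_fixpoint (J T : Type) (x0 : T)
    (Gam : (J -> nat -> T) -> J -> nat -> T) :
    (forall n X X', (forall j k, (k < n)%N -> X j k = X' j k) ->
      forall j, Gam X j n = Gam X' j n) ->
  exists X, forall j n, X j n = Gam X j n.
Proof.
move=> causal; pose it N := iter N Gam (fun _ _ => x0).
have itE n N j : (n < N)%N -> it N j n = it n.+1 j n.
  elim/ltn_ind: n N j => n IH [|N] j // nN.
  apply: (causal n) => i k kn.
  have Nk : (k < N)%N by exact: leq_trans kn nN.
  by transitivity (it k.+1 i k); [exact: IH|symmetry; exact: IH].
exists (fun j n => it n.+1 j n) => j n.
by apply: (causal n) => i k kn; exact: itE.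
Qed.

Section Combination.
Context (R : realType) (S : comAlgType R) (J : Type).

(** The point is that W does not depend on j: a linear relation between the
    functions [c j] on P gives the same relation between the [X j]. *)
Definition combination (T : eqType) (c : J -> T -> R) (P : pred T) (X : J -> S) :=
  exists2 W : seq (T * S), all (fun x => P x.1) W &
    forall j, X j = \sum_(x <- W) c j x.1 *: x.2.

Lemma combination0 (T : eqType) (c : J -> T -> R) (P : pred T) :
  combination c P (fun=> 0).
Proof. by exists [::] => // j; rewrite big_nil. Qed.

Lemma combinationD (T : eqType) (c : J -> T -> R) (P : pred T) (X : J -> S) Y :
  combination c P X -> combination c P Y ->
  combination c P (fun j => X j + Y j).
Proof.
move=> [W WP WE] [W' WP' WE']; exists (W ++ W'); first by rewrite all_cat WP.
by move=> j; rewrite big_cat WE WE'.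
Qed.

Lemma combination_sum (T : eqType) (c : J -> T -> R) (P : pred T)
    (I : Type) (r : seq I) (X : I -> J -> S) :
  (forall i, combination c P (X i)) ->
  combination c P (fun j => \sum_(i <- r) X i j).
Proof.
move=> XP; elim: r => [|i r IH].
  have [W WP WE] := combination0 c P.
  by exists W => // j; rewrite big_nil -WE.
have [W WP WE] := combinationD (XP i) IH.
by exists W => // j; rewrite big_cons -WE.
Qed.

Lemma combination_linear (T : eqType) (c : J -> T -> R) (P : pred T)
    (X : J -> S) (g : {linear S -> S}) :
  combination c P X -> combination c P (fun j => g (X j)).
Proof.
move=> [W WP WE]; exists [seq (x.1, g x.2) | x <- W]; first by rewrite all_map.
by move=> j; rewrite WE big_map linear_sum; apply: eq_bigr => x _; rewrite linearZ.
Qed.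

Lemma combination_map (T T' : eqType) (c : J -> T -> R) (c' : J -> T' -> R)
    (P : pred T) (P' : pred T') (d : J -> R) (m : T -> T') (X : J -> S) :
  (forall t, P t -> P' (m t)) ->
  (forall j t, P t -> c' j (m t) = d j * c j t) ->
  combination c P X -> combination c' P' (fun j => d j *: X j).
Proof.
move=> mP mc [W WP WE]; exists [seq (m x.1, x.2) | x <- W].
  by rewrite all_map; apply: sub_all WP => x /mP.
move=> j; rewrite WE big_map scaler_sumr big_seq [RHS]big_seq.
by apply: eq_bigr => x /(allP WP) Px; rewrite mc // scalerA.
Qed.

Lemma combinationM (T1 T2 T3 : eqType) (c1 : J -> T1 -> R) (c2 : J -> T2 -> R)
    (c3 : J -> T3 -> R) (P1 : pred T1) (P2 : pred T2) (P3 : pred T3)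
    (m : T1 -> T2 -> T3) (X Y : J -> S) :
  (forall t1 t2, P1 t1 -> P2 t2 -> P3 (m t1 t2)) ->
  (forall j t1 t2, c3 j (m t1 t2) = c1 j t1 * c2 j t2) ->
  combination c1 P1 X -> combination c2 P2 Y ->
  combination c3 P3 (fun j => X j * Y j).
Proof.
move=> mP mc [W1 WP1 WE1] [W2 WP2 WE2].
exists [seq (m x.1 y.1, x.2 * y.2) | x <- W1, y <- W2].
  apply/allP => z /allpairsP[[x y] /= [xW yW ->]] /=.
  by apply: mP; [exact: (allP WP1)|exact: (allP WP2)].
move=> j; rewrite WE1 WE2 mulr_suml big_flatten big_map; apply: eq_bigr => x _.
rewrite mulr_sumr big_map; apply: eq_bigr => y _ /=.
by rewrite mc -scalerAl -scalerAr scalerA.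
Qed.

End Combination.

Section Weights.
Context (R : realType) (s : nat) (A : 'M[R]_s).
Implicit Types (j : option 'I_s) (t : ptree) (l : seq ptree).

Fixpoint stage_weight t : 'cV[R]_s :=
  let: PNode l := t in
  foldr (@cmul R s) (const_mx 1) (map (fun t => A *m stage_weight t) l).

(** The index None stands for the exact flow, treated as one more stage. *)
Definition weight j t : R :=
  if j is Some i then stage_weight t i 0 else (ptree_fact t)%:R^-1.

Definition mix (V : lmodType R) (X : option 'I_s -> V) j : V :=
  if j is Some i then \sum_k A i k *: X (Some k) else X None.

Definition mix_weight j t : R := mix (fun k => weight k t : R^o) j.

Definition forest_weight j l : R := \prod_(t <- l) mix_weight j t.

Definition stage_denom j n : R := if j is Some _ then 1 else n%:R.

Lemma stage_weight_node l i :
  stage_weight (PNode l) i 0 = \prod_(t <- l) (A *m stage_weight t) i 0.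
Proof.
elim: l => [|t l IH]; first by rewrite big_nil mxE.
by rewrite big_cons -IH /= /cmul mxE.
Qed.

Lemma weight_node j l :
  weight j (PNode l) = (stage_denom j (ptree_size (PNode l)))^-1 * forest_weight j l.
Proof.
case: j => [i|]; rewrite /weight /forest_weight /stage_denom.
  rewrite invr1 mul1r stage_weight_node; apply: eq_bigr => t _; rewrite mxE.
  by apply: eq_bigr => k _.
rewrite [ptree_fact _]/= natrM invfM; congr (_ * _).
elim: l => [|t l IH]; first by rewrite big_nil invr1.
by rewrite big_cons /= natrM invfM IH.
Qed.

End Weights.

Section Stages.
Context (R : realType) (L : lmodType R) (tri : {bilinear L -> L -> L}).
Context (S : comAlgType R) (iota : {linear L -> S}) (E : enveloping tri iota).
Context (s : nat) (A : 'M[R]_s) (f : L).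
Implicit Types (X : option 'I_s -> nat -> S).

(** The exact flow Y is a stage that reads itself only, and whose equation is
    integrated in h: this divides the coefficient of h^n by n. *)
Definition stage_system X := forall j,
  X j 0%N = 0 /\ forall n, X j n.+1 =
    (stage_denom R j n.+1)^-1 *: ext E (series_exp *%R (mix A X j) n) (iota f).

Lemma mixE X j n : mix A X j n = mix A (fun k => X k n) j.
Proof. by case: j => [i|] //=; rewrite fct_sumE. Qed.

Lemma mix0 X j : (forall k, X k 0%N = 0) -> mix A X j 0%N = 0.
Proof.
move=> X0; rewrite mixE; case: j => [i|] /=; rewrite ?X0 //.
by apply: big1 => k _; rewrite X0 scaler0.
Qed.

Lemma stage_system_ex : exists X, stage_system X.
Proof.
(* The value at 0 is reset so that Gam is causal on arbitrary families. *)
pose reset X : option 'I_s -> nat -> S :=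
  fun j n => if n is 0 then 0 else X j n.
pose Gam X : option 'I_s -> nat -> S := fun j n => if n is n'.+1 then
  (stage_denom R j n)^-1 *: ext E (series_exp *%R (mix A (reset X) j) n') (iota f)
  else 0.
have [|X XE] := @causal_fixpoint _ _ 0 Gam.
  move=> [|n] X X' XX' j //=; congr (_ *: ext E _ _).
  apply: eq_series_exp => [|k kn]; first exact: mix0.
  rewrite !mixE; case: j => [i|] /=; last by case: k kn => // k kn; exact: XX'.
  by apply: eq_bigr => l _; case: k kn => // k kn; rewrite /= XX'.
have rX : reset X = X.
  by apply/funext => j; apply/funext => -[|n] //=; rewrite XE.
by exists X => j; split=> [|n]; rewrite XE //= rX.
Qed.

Section Solution.
Context (X : option 'I_s -> nat -> S) (XP : stage_system X).

Let X0 j : X j 0%N = 0. Proof. by have [] := XP j. Qed.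

Lemma stage_iota n j : exists x, X j n = iota x.
Proof.
elim/ltn_ind: n j => -[_|n IH] j; first by exists 0; rewrite X0 linear0.
have [_ ->] := XP j.
have aP : acts_in_iota E (series_exp *%R (mix A X j) n).
  apply: series_exp_acts => [|k kn]; first exact: mix0.
  rewrite mixE; case: j => [i|] /=; last exact: IH.
  apply: (big_ind (fun a => exists x, a = iota x)).
  - by exists 0; rewrite linear0.
  - by move=> _ _ [x ->] [y ->]; exists (x + y); rewrite linearD.
  - move=> l _; have [x ->] := IH k kn (Some l).
    by exists (A i l *: x); rewrite linearZ.
by have [z ->] := aP f; exists ((stage_denom R j n.+1)^-1 *: z); rewrite linearZ.
Qed.

(** Expanding the exponential into products and attaching a root turns forests
    of total size n into trees of size n + 1.  Elementary differentials and
    symmetry factors remain hidden in the coefficients, which are common to all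
    stages and to the exact flow. *)
Lemma stage_combination n :
  combination (weight A) (fun t => ptree_size t == n) (fun j => X j n).
Proof.
elim/ltn_ind: n => -[_|n IH].
  by have [W WP WE] := combination0 S (weight A) (fun t => ptree_size t == 0%N);
     exists W => // j; rewrite X0 -WE.
have mixP k : (k <= n)%N -> combination (mix_weight A)
    (fun t => ptree_size t == k) (fun j => mix A X j k).
  move=> kn; have [W WP WE] := IH k kn; exists W => // j; rewrite mixE.
  case: j => [i|] /=; rewrite ?WE // /mix_weight /=.
  rewrite (eq_bigr (fun l => \sum_(x <- W) (A i l * weight A (Some l) x.1) *: x.2)).
    by rewrite exchange_big; apply: eq_bigr => x _; rewrite scaler_suml.
  by move=> l _; rewrite WE scaler_sumr; apply: eq_bigr => x _; rewrite scalerA.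
have powP m : forall k, (k <= n)%N -> combination (forest_weight A)
    (fun l => sumn (map ptree_size l) == k) (fun j => spow (mix A X j) m k).
  elim: m => [|m IHm] k kn.
    rewrite /spow /= /hmonom; case: eqP => [->|_]; last exact: combination0.
    exists [:: ([::], 1)] => // j.
    by rewrite big_seq1 /forest_weight big_nil scale1r.
  rewrite /spow /=; apply: combination_sum => i.
  have ik : (i <= k)%N by exact: leq_ord.
  apply: (combinationM (m := cons) _ _ (mixP i _) (IHm _ _)).
  - by move=> t l /eqP ti /eqP li; rewrite /= ti li subnKC.
  - by move=> j t l; rewrite /forest_weight big_cons.
  - exact: leq_trans kn.
  - by rewrite (leq_trans (leq_subr _ _)).
have expP : combination (forest_weight A)
    (fun l => sumn (map ptree_size l) == n)
    (fun j => series_exp *%R (mix A X j) n).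
  have [W WP WE] : combination (forest_weight A)
      (fun l => sumn (map ptree_size l) == n)
      (fun j => \sum_(m < n.+1) (m`!%:R)^-1 *: spow (mix A X j) m n).
    apply: combination_sum => m.
    exact: (combination_linear ( *:%R ((m`!%:R)^-1 : R)) (powP m n (leqnn n))).
  by exists W => // j; rewrite (@series_expE _ _ n.+1) // mix0.
have [||W WP WE] := combination_map (m := PNode) (c' := weight A)
  (P' := fun t => ptree_size t == n.+1) (d := fun j => (stage_denom R j n.+1)^-1)
  _ _ (combination_linear (applyr (ext E) (iota f)) expP).
- by move=> l; rewrite /= eqSS.
- by move=> j l /eqP ln; rewrite weight_node /= ln.
- by exists W => // j; have [_ ->] := XP j; rewrite -WE.
Qed.

End Solution.

End Stages.

Lemma cauchy_hmonom1 (R : realType) (S : lmodType R) (op : {bilinear S -> S -> S})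
    (u : nat -> S) (a : S) n :
  cauchy op u (hmonom 1 a) n = if n is n'.+1 then op (u n') a else 0.
Proof.
case: n => [|n]; rewrite /cauchy.
  by rewrite big_ord1 /hmonom linear0r.
rewrite big_ord_recr big_ord_recr /= big1 => [|i _].
  by rewrite add0r subSnn subnn /hmonom /= linear0r addr0.
rewrite /hmonom ifN ?linear0r // subSn ?(ltnW (ltn_ord i)) //.
by rewrite eqSS subn_eq0 -ltnNge ltn_ord.
Qed.

(** The method and the exact flow are the exponentials of two series whose
    coefficients are combinations of the weights of trees, with the same
    coefficients: order p only requires the weights to agree up to p nodes. *)
Lemma rk_order_weights (R : realType) (s : nat) (A : 'M[R]_s) (b : 'rV[R]_s)
    (p : nat) (L : lmodType R) (tri : {bilinear L -> L -> L}) :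
  (forall t, (ptree_size t <= p)%N ->
    (b *m stage_weight A t) 0 0 = (ptree_fact t)%:R^-1) ->
  rk_order A b p tri.
Proof.
move=> orderP S iota E _ f /= n np.
rewrite -[RHS](subrr (rk_series E A b (hmonom 1 (iota f)) n)).
rewrite [LHS]addfE; congr (_ - _).
have [X XP] := stage_system_ex E A f.
set K := rk_stages (series_exp *%R) (cauchy (ext E)) (stage_series iota) A
  (hmonom 1 (iota f)).
have KP : (forall i, stage_series iota (K i)) /\ forall i, K i =
    cauchy (ext E) (series_exp *%R (\sum_j A i j *: K j)) (hmonom 1 (iota f)).
  apply: (@xgetPex _ (fun=> 0) [set K0 : 'I_s -> nat -> S |
     (forall i, stage_series iota (K0 i)) /\ forall i, K0 i =
     cauchy (ext E) (series_exp *%R (\sum_j A i j *: K0 j)) (hmonom 1 (iota f))]).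
  exists (fun i => X (Some i)); split=> i.
    split=> [[|k] //|k]; last exact: stage_iota XP _ _.
    by have [] := XP (Some i).
  apply/funext => k; rewrite cauchy_hmonom1.
  have [X0 XS] := XP (Some i).
  by case: k => [//|k]; rewrite XS /= invr1 scale1r.
(* K is only known to solve the equations of the stages; joined with the exact
   flow of X, it solves the whole system. *)
pose X' j := if j is Some i then K i else X None.
have X'P : stage_system E A f X'.
  case=> [i|]; last exact: XP.
  have [[K0 _] KE] := (KP.1 i, KP.2 i); split=> [|k]; first exact: K0.
  by rewrite /X' KE cauchy_hmonom1 invr1 scale1r.
have [Y0 YS] := XP None.
rewrite (@star_series_exp _ _ _ _ _ E f (X None)) //; last first.
  by move=> k; rewrite YS scalerA divff ?scale1r // pnatr_eq0.
rewrite /rk_series /rk_map -/K; symmetry; apply: eq_series_exp.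
  rewrite fct_sumE; apply: big1 => j _.
  by rewrite [_ _ 0%N](congr1 (GRing.scale _) ((KP.1 j).1 0%N isT)) scaler0.
move=> k kn; have [W WP WE] := stage_combination X'P k.
rewrite fct_sumE.
rewrite [LHS](eq_bigr (fun j : 'I_s =>
  \sum_(x <- W) (b 0 j * weight A (Some j) x.1) *: x.2)); last first.
  move=> j _; rewrite [LHS](congr1 (GRing.scale _) (WE (Some j))) scaler_sumr.
  by apply: eq_bigr => x _; rewrite scalerA.
rewrite [RHS](WE None) exchange_big /= big_seq [RHS]big_seq.
apply: eq_bigr => x /(allP WP) /eqP xk; rewrite -scaler_suml; congr (_ *: _).
by rewrite -orderP ?mxE // xk (leq_trans kn).
Qed.

(** * Forests and grafting *)

Section Forests.
Implicit Types (t : tree) (w : forest) (l : seq ptree).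

Lemma forest_of_cons t ts : forest_of (t :: ts) = mmul (ucm t) (forest_of ts).
Proof. exact: big_cons. Qed.

Lemma forest_ofE ts t : forest_of ts t = count_mem t ts.
Proof.
elim: ts => [|u ts IH]; first by rewrite /forest_of big_nil cm1.
by rewrite forest_of_cons cmM cmU IH.
Qed.

Lemma count_seq_of_forest w t : count_mem t (seq_of_forest w) = w t.
Proof.
rewrite /seq_of_forest count_flatten -map_comp sumnE big_map.
have [tw|tw] := boolP (t \in finsupp w).
  rewrite (big_fsetD1 t) //= count_nseq /= eqxx mul1n big1_seq ?addn0 // => u /=.
  by rewrite count_nseq /= in_fsetD1 => /andP[/negPf -> _].
rewrite big1_seq => [|u /= uw]; first by apply/esym/eqP; rewrite cmE_eq0.
by rewrite count_nseq /=; case: eqP uw tw => // -> ->.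
Qed.

Lemma forest_ofK ts : perm_eq (seq_of_forest (forest_of ts)) ts.
Proof. by apply/allP => t _ /=; rewrite count_seq_of_forest forest_ofE. Qed.

Lemma seq_of_forestK : cancel seq_of_forest forest_of.
Proof.
by move=> w; apply/eqP/cmP => t; rewrite forest_ofE count_seq_of_forest.
Qed.

Lemma big_seq_of_forest (T : Type) (idx : T) (op : Monoid.com_law idx)
    (F : tree -> T) w :
  \big[op/idx]_(t <- seq_of_forest w) F t
  = \big[op/idx]_(t <- finsupp w) iterop (w t) op (F t) idx.
Proof.
rewrite /seq_of_forest big_flatten big_map; apply: eq_bigr => t _.
by rewrite big_nseq Monoid.iteropE.
Qed.

Lemma canon_tree t : ptree_canon t = t.
Proof. by case: t => t /= /eqP. Qed.

Lemma tree_valK : cancel tree_val mktree.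
Proof. by move=> t; apply/val_inj/canon_tree. Qed.

Lemma mktree_node l : mktree (PNode l) = Bplus (forest_of (map mktree l)).
Proof.
apply/val_inj/ptree_canon_nodeP; rewrite -!map_comp.
rewrite (eq_map (f := ptree_canon) (g := tree_val \o mktree)) //.
rewrite (eq_map (f := ptree_canon \o tree_val) canon_tree) map_comp.
by rewrite perm_sym perm_map // forest_ofK.
Qed.

Lemma Bplus_inj : injective Bplus.
Proof.
move=> w w' /(congr1 tree_val)/ptree_canon_nodeP; rewrite -!map_comp.
rewrite !(eq_map (f := ptree_canon \o tree_val) canon_tree).
move=> /(perm_map_inj val_inj)/permP eqw; apply/eqP/cmP => t.
by rewrite -!count_seq_of_forest eqw.
Qed.

Lemma BplusP t : exists w, t = Bplus w.
Proof.
by rewrite -[t]tree_valK; case: (tree_val t) => l; rewrite mktree_node; eexists.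
Qed.

Lemma tree_val_Bplus w : exists2 ts, w = forest_of ts &
  tree_val (Bplus w) = PNode (map tree_val ts).
Proof.
case E: (tree_val (Bplus w)) => [l].
have lK : map tree_val (map mktree l) = l.
  have := canon_tree (Bplus w); rewrite E => -[lE].
  rewrite -map_comp -[RHS]map_id; apply/eq_in_map => t; rewrite -{1}lE mem_sort.
  by move=> /mapP[u _ ->]; exact: ptree_canonK.
exists (map mktree l); last by rewrite lK.
by apply: Bplus_inj; rewrite -mktree_node -E tree_valK.
Qed.

Lemma foldr_muln (T : Type) (F : T -> nat) (r : seq T) :
  foldr muln 1%N (map F r) = (\prod_(x <- r) F x)%N.
Proof. by rewrite foldrE big_map. Qed.

Lemma ptree_sym_gt0 (t : ptree) : (0 < ptree_sym t)%N.
Proof.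
elim/ptree_seq_ind: t => l IH /=; rewrite muln_gt0 foldr_muln.
rewrite big_seq !prodn_cond_gt0 // => u _; exact: fact_gt0.
Qed.

Lemma tree_sym_Bplus w : tree_sym (Bplus w) = forest_sym w.
Proof.
rewrite /tree_sym; have [ts wE ->] := tree_val_Bplus w.
rewrite /= foldr_muln big_map /forest_sym big_split /=; congr (_ * _)%N.
  rewrite -(perm_big _ (forest_ofK ts)) -wE big_seq_of_forest.
  by apply: eq_bigr => t _.
rewrite (undup_map_inj val_inj) big_map.
rewrite (perm_big (finsupp w)) /=.
  apply: eq_bigr => t _; rewrite wE forest_ofE count_map.
  by congr (_ `!); apply: eq_count => u; rewrite /= (inj_eq val_inj).
apply: uniq_perm => [||t]; rewrite ?undup_uniq ?fset_uniq // mem_undup.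
by rewrite -cmE_neq0 wE forest_ofE -lt0n -has_count has_pred1.
Qed.

Lemma forest_sym_ucm t : forest_sym (ucm t) = tree_sym t.
Proof. by rewrite /forest_sym mdomU big_seq_fset1 cmUU expn1 muln1. Qed.

Lemma ptree_size_canon (t : ptree) : ptree_size (ptree_canon t) = ptree_size t.
Proof.
elim/ptree_seq_ind: t => l IH /=; congr _.+1.
rewrite (perm_sumn (perm_map _ (permEl (perm_sort _ _)))) -map_comp.
by congr sumn; apply/eq_in_map => u /IH.
Qed.

Lemma ptree_fact_canon (t : ptree) : ptree_fact (ptree_canon t) = ptree_fact t.
Proof.
have factE l :
    ptree_fact (PNode l) = (ptree_size (PNode l) * \prod_(u <- l) ptree_fact u)%N.
  by rewrite -foldr_muln.
elim/ptree_seq_ind: t => l IH; have := ptree_size_canon (PNode l).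
rewrite [ptree_canon _]/= !factE => ->; congr (_ * _)%N.
rewrite (perm_big _ (permEl (perm_sort _ _))) big_map /=.
by rewrite big_seq [RHS]big_seq; apply: eq_bigr => u /IH.
Qed.

(** The recursion on forests inside [ptree_grafts], in the same form so that
    both are convertible. *)
Definition forest_grafts (u : ptree) : seq ptree -> seq (seq ptree) :=
  fix below l := if l is x :: l' then
    [seq y :: l' | y <- ptree_grafts u x] ++ [seq x :: m | m <- below l']
  else [::].

Lemma ptree_grafts_node u l :
  ptree_grafts u (PNode l) = PNode (u :: l) :: map PNode (forest_grafts u l).
Proof. by []. Qed.

Lemma size_forest_grafts u l m : m \in forest_grafts u l -> size m = size l.
Proof.
elim: l m => [//|x l IH] m; rewrite mem_cat => /orP[] /mapP[y yP ->] //=.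
by rewrite (IH y).
Qed.

Lemma mul_divcm w t : t \in finsupp w -> mmul (ucm t) (divcm w (ucm t)) = w.
Proof.
rewrite -cmE_neq0 -lt0n => tw; apply/eqP/cmP => z.
by rewrite cmM divcmE cmU subnKC //; case: eqP => // <-.
Qed.

Lemma mdeg_forest_of ts : mdeg (forest_of ts) = size ts.
Proof.
elim: ts => [|t ts IH]; first by rewrite /forest_of big_nil mdeg1.
by rewrite forest_of_cons mdegM mdegU IH.
Qed.

End Forests.

Section Grafting.
Context (R : realType) (E : enveloping (@graft R) (@forest_iota R)).
Local Notation "<[ w ]>" := (<< w >> : {malg R[forest]}).
Implicit Types (t : tree) (w : forest).

Lemma malg_mulU (w w' : forest) : <[ w ]> * <[ w' ]> = <[ mmul w w' ]>.
Proof. by rewrite malgM_def fgmulUU mulr1. Qed.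

Lemma forest_iotaU t : forest_iota << t >> = <[ ucm t ]>.
Proof. exact: malg_liftU. Qed.

Lemma graftU t u : graft << t >> << u >>
  = \sum_(v <- ptree_grafts t u) << mktree v >> :> {malg R[tree]}.
Proof. by rewrite /graft !malg_liftU. Qed.

Lemma ext_tree_tree t u : ext E (forest_iota << t >>) (forest_iota << u >>)
  = \sum_(v <- ptree_grafts t u) <[ ucm (mktree v) ]>.
Proof.
rewrite ext_iota; apply: etrans (congr1 (@forest_iota R) (graftU t u)) _.
by rewrite linear_sum; apply: eq_bigr => v _; exact: forest_iotaU.
Qed.

Lemma ext_tree_forest t ts : ext E <[ ucm t ]> <[ forest_of ts ]>
  = \sum_(m <- forest_grafts t (map tree_val ts)) <[ forest_of (map mktree m) ]>.
Proof.
rewrite -forest_iotaU; elim: ts => [|u ts IH].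
  by rewrite /forest_of !big_nil ext_iota1.
rewrite forest_of_cons -malg_mulU ext_iotaM.
apply: etrans (congr1 (fun x => _ + <[ ucm u ]> * x) IH) _.
rewrite /= big_cat !big_map /=.
congr (_ + _).
  rewrite -forest_iotaU ext_tree_tree mulr_suml.
  apply: eq_bigr => v _; rewrite malg_mulU -forest_of_cons /=.
  by rewrite -map_comp (eq_map tree_valK) map_id.
rewrite mulr_sumr; apply: eq_bigr => m _.
by rewrite malg_mulU -forest_of_cons tree_valK.
Qed.

(** In (t w) |> bullet = t |> (w |> bullet) - (t |> w) |> bullet, the first
    term grafts t on every node of the tree B+(w), and the second one removes
    the graftings on nodes of w: only the grafting on the root survives. *)
Lemma ext_forest_bullet w : ext E <[ w ]> <[ ucm bullet ]> = <[ ucm (Bplus w) ]>.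
Proof.
have [n] := ubnP (mdeg w); elim: n w => // n IH w.
rewrite -[w]seq_of_forestK mdeg_forest_of.
case: (seq_of_forest w) => [|t us].
  by rewrite /forest_of big_nil => _; rewrite ext_one.
rewrite /= !ltnS => usn; rewrite forest_of_cons.
have [ts usE BE] := tree_val_Bplus (forest_of us).
have tsn : (size ts < n)%N by rewrite -mdeg_forest_of -usE mdeg_forest_of.
have graft_tree : ext E <[ ucm t ]> (ext E <[ forest_of us ]> <[ ucm bullet ]>)
    = \sum_(v <- ptree_grafts t (Bplus (forest_of us))) <[ ucm (mktree v) ]>.
  rewrite [X in ext E _ X]IH ?mdeg_forest_of //.
  rewrite -ext_tree_tree.
  by rewrite !forest_iotaU.
have graft_forest : ext E (ext E <[ ucm t ]> <[ forest_of us ]>) <[ ucm bullet ]>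
    = \sum_(m <- forest_grafts t (map tree_val ts))
        <[ ucm (mktree (PNode m)) ]>.
  rewrite usE.
  rewrite ext_tree_forest.
  rewrite linear_sumlz /= big_seq [RHS]big_seq.
  apply: eq_bigr => m mP; rewrite mktree_node IH //.
  by rewrite mdeg_forest_of size_map (size_forest_grafts mP) size_map.
rewrite -malg_mulU.
have -> : ext E (<[ ucm t ]> * <[ forest_of us ]>) <[ ucm bullet ]>
    = ext E <[ ucm t ]> (ext E <[ forest_of us ]> <[ ucm bullet ]>)
      - ext E (ext E <[ ucm t ]> <[ forest_of us ]>) <[ ucm bullet ]>.
  by rewrite -!forest_iotaU; exact: ext_mul_iota.
rewrite graft_tree graft_forest BE.
rewrite ptree_grafts_node big_cons big_map.
rewrite addrK mktree_node /= tree_valK -map_comp (eq_map tree_valK) map_id.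
by rewrite forest_of_cons usE.
Qed.

End Grafting.

(** * Tree series and their exponential *)

Section TreeSeries.
Context (R : realType).
Local Notation fseries := (forest -> R^o).
Local Notation "<[ w ]>" := (<< w >> : {malg R[forest]}).
Implicit Types (u v : fseries) (t : tree) (w : forest).

Definition tree_exp u w : R :=
  \prod_(t <- finsupp w) (u (ucm t) ^+ w t / (w t)`!%:R).

(** A tree series is supported on one-tree forests, so that the product reduces
    to the removal of one tree. *)
Lemma completed_tree u v w : tree_series u -> completed *%R u v w
  = \sum_(t <- finsupp w) u (ucm t) * v (divcm w (ucm t)).
Proof.
move=> uT; rewrite /completed.
have mulE (x : forest * forest) :
    (<[ x.1 ]> * <[ x.2 ]>)@_w = (mmul x.1 x.2 == w)%:R :> R.
  by rewrite malg_mulU mcoeffU1.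
rewrite (fsbigTE [fset (ucm t, divcm w (ucm t)) | t in finsupp w]%fset).
  rewrite big_imfset /= => [|t z _ _ [/eqP/cmP/(_ t)]]; last first.
    by rewrite !cmU eqxx => + _; case: eqP.
  rewrite big_seq [RHS]big_seq; apply: eq_bigr => t tw.
  apply: etrans (congr1 ( *%R _) (mulE (ucm t, divcm w (ucm t)))) _ => /=.
  by rewrite mul_divcm // eqxx mulr1.
case=> x y xyN; apply: etrans (congr1 ( *%R _) (mulE (x, y))) _ => /=.
case: eqP xyN => [xyw|_ _]; last by rewrite mulr0.
have [->|/uT[t xE]] := eqVneq (u x) 0; first by rewrite !mul0r.
case/negP; apply/imfsetP; exists t => /=.
  by rewrite -cmE_neq0 -xyw xE cmM cmUU.
rewrite -xE; congr (_, _); apply/eqP/cmP => z.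
by rewrite divcmE -xyw cmM addKn.
Qed.

Lemma tree_exp_div u w t : t \in finsupp w ->
  u (ucm t) * tree_exp u (divcm w (ucm t)) = (w t)%:R * tree_exp u w.
Proof.
move=> tw; have -> : tree_exp u (divcm w (ucm t)) = \prod_(z <- finsupp w)
    (u (ucm z) ^+ divcm w (ucm t) z / (divcm w (ucm t) z)`!%:R).
  apply: big_fset_incl => [|z _]; last first.
    by rewrite -cmE_eq0 => /eqP ->; rewrite expr0 fact0 divr1.
  apply/fsubsetP => z; rewrite -!cmE_neq0 divcmE; apply: contraNN => /eqP ->.
  by rewrite sub0n.
rewrite /tree_exp (big_fsetD1 t) // [X in _ = _ * X](big_fsetD1 t) //=.
rewrite mulrA [RHS]mulrA; congr (_ * _).
  move: tw; rewrite divcmE cmUU -cmE_neq0; case: (w t) => // k _.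
  rewrite subn1 /= exprS factS natrM invfM -!mulrA [RHS]mulrCA; congr (_ * _).
  by rewrite [RHS]mulrCA mulVKf // pnatr_eq0.
rewrite big_seq [RHS]big_seq; apply: eq_bigr => z; rewrite in_fsetD1.
by case/andP=> zt _; rewrite divcmE cmU eq_sym (negPf zt) subn0.
Qed.

(** The n-th power of a tree series is carried by the forests with n trees,
    each forest being counted once for every ordering of its trees. *)
Lemma tree_power u n w : tree_series u ->
  iter n (completed *%R u) (Defs.fmonom R mone) w
  = if mdeg w == n then n`!%:R * tree_exp u w else 0.
Proof.
move=> uT; elim: n w => [|n IH] w.
  rewrite /= /Defs.fmonom mdeg_eq0; case: eqP => // ->.
  by rewrite /tree_exp mdom1 big_seq_fset0 mulr1.
rewrite iterS completed_tree //.
have degE t : t \in finsupp w -> (mdeg (divcm w (ucm t)) == n) = (mdeg w == n.+1).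
  by move=> tw; rewrite -[in RHS](mul_divcm tw) mdegM mdegU.
rewrite big_seq (eq_bigr (fun t =>
    if mdeg w == n.+1 then n`!%:R * ((w t)%:R * tree_exp u w) else 0)).
  rewrite -big_seq; case: eqP => [wn|_]; last by apply: big1.
  rewrite -mulr_sumr -mulr_suml -natr_sum -mdegE wn factS natrM.
  by rewrite mulrA (mulrC n.+1%:R).
move=> t tw; rewrite IH degE //; case: eqP => _; last by rewrite mulr0.
by rewrite -tree_exp_div // mulrCA.
Qed.

Lemma forest_expE u w : tree_series u -> forest_exp u w = tree_exp u w.
Proof.
move=> uT; rewrite /forest_exp /formal_exp (fsbigTE [fset mdeg w]%fset).
  rewrite big_seq_fset1 tree_power // eqxx.
  by rewrite [LHS]mulrA mulVf ?mul1r // pnatr_eq0 -lt0n fact_gt0.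
move=> n; rewrite inE => nw; rewrite tree_power // eq_sym (negPf nw).
exact: scaler0.
Qed.

Lemma tree_exp_ucm u t : tree_exp u (ucm t) = u (ucm t).
Proof. by rewrite /tree_exp mdomU big_seq_fset1 cmUU expr1 invr1 mulr1. Qed.

(** The symmetry factor of a forest turns divided powers into products over
    the trees of the forest. *)
Lemma tree_exp_sym u w : tree_exp u w * (forest_sym w)%:R
  = \prod_(t <- seq_of_forest w) (u (ucm t) * (tree_sym t)%:R).
Proof.
rewrite big_seq_of_forest /tree_exp /forest_sym natr_prod -big_split /=.
apply: eq_bigr => t _; rewrite natrM natrX -[RHS]/((_ * _) ^+ _) exprMn.
by rewrite mulrACA mulVf ?mulr1 // pnatr_eq0 -lt0n fact_gt0.
Qed.

Lemma pairing_ucm u t : pairing u (ucm t) = u (ucm t) * (tree_sym t)%:R.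
Proof.
rewrite /pairing (fsbigTE [fset ucm t]%fset).
  by rewrite big_seq_fset1 /forest_pairing eqxx forest_sym_ucm.
by move=> w; rewrite inE /forest_pairing => /negPf ->; rewrite mulr0.
Qed.

Lemma tree_series_sum s (a : 'I_s -> R) (K : 'I_s -> fseries) :
  (forall j, tree_series (K j)) -> tree_series (\sum_j a j *: K j).
Proof.
move=> KT w; rewrite fct_sumE => /eqP; apply: contra_notP => wN.
apply: big1 => j _; have [Kw|/KT //] := eqVneq (K j w) 0.
by rewrite [LHS](congr1 (GRing.scale (a j)) Kw) scaler0.
Qed.

End TreeSeries.

(** * Runge-Kutta stages as tree series *)

Section CharacterStages.
Context (R : realType) (E : enveloping (@graft R) (@forest_iota R)).
Context (s : nat) (A : 'M[R]_s).
Local Notation fseries := (forest -> R^o).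
Implicit Types (u v : fseries) (t : tree) (w : forest).

Lemma completed_bullet u w :
  completed (ext E) u (Defs.fmonom R (ucm bullet)) (ucm (Bplus w)) = u w.
Proof.
rewrite /completed (fsbigTE [fset (w, ucm bullet)]%fset).
  rewrite big_seq_fset1 /= /Defs.fmonom eqxx mulr1 ext_forest_bullet.
  by rewrite mcoeffUU mulr1.
case=> x y; rewrite inE xpair_eqE /= /Defs.fmonom.
case: (y =P ucm bullet) => [->|_ _]; last by rewrite mulr0 mul0r.
rewrite andbT ext_forest_bullet mcoeffU1 => /eqP xwN.
case: eqP => [xw|]; last by rewrite mulr0.
case: xwN; apply: Bplus_inj; move/eqP/cmP: xw => /(_ (Bplus w)).
by rewrite !cmU eqxx; case: eqP.
Qed.

Lemma completed_bullet_tree u :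
  tree_series (completed (ext E) u (Defs.fmonom R (ucm bullet))).
Proof.
move=> w; apply: contra_neqP => wN; apply: fsbig1 => -[x y] _ /=; rewrite /Defs.fmonom.
case: (y =P ucm bullet) => [->|_]; last by rewrite mulr0 mul0r.
rewrite ext_forest_bullet mcoeffU1; case: eqP => [xw|]; last by rewrite mulr0.
by case: wN; exists (Bplus x).
Qed.

(** The weight of a tree is the coefficient of the stage multiplied by the
    symmetry factor of the tree, which gives this solution. *)
Definition weight_series (i : 'I_s) : fseries := fun w =>
  \sum_(t <- finsupp w) (w == ucm t)%:R * (stage_weight A t i 0 / (tree_sym t)%:R).

Lemma weight_series_ucm i t :
  weight_series i (ucm t) = stage_weight A t i 0 / (tree_sym t)%:R.
Proof. by rewrite /weight_series mdomU big_seq_fset1 eqxx mul1r. Qed.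

Lemma weight_series_tree i : tree_series (weight_series i).
Proof.
move=> w; apply: contra_neqP => wN; apply: big1 => t _.
by case: eqP => [wt|_]; rewrite ?mul0r //; case: wN; exists t.
Qed.

Lemma weight_series_stage i : weight_series i = completed (ext E)
  (forest_exp (\sum_j A i j *: weight_series j)) (Defs.fmonom R (ucm bullet)).
Proof.
set v := completed _ _ _; apply/funext => w.
have [[t ->]|wN] := pselect (exists t, w = ucm t); last first.
  have [->|/weight_series_tree //] := eqVneq (weight_series i w) 0.
  by have [->|/completed_bullet_tree //] := eqVneq (v w) 0.
have [w' ->] := BplusP t.
rewrite /v completed_bullet forest_expE; last first.
  by apply: tree_series_sum => j; exact: weight_series_tree.
have sym_neq0 t' : (tree_sym t')%:R != 0 :> R.
  by rewrite pnatr_eq0 -lt0n ptree_sym_gt0.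
apply: (mulIf (sym_neq0 (Bplus w'))).
rewrite weight_series_ucm divfK // tree_sym_Bplus tree_exp_sym.
have [ts w'E ->] := tree_val_Bplus w'.
rewrite stage_weight_node big_map w'E (perm_big _ (forest_ofK ts)) /=.
apply: eq_bigr => t' _; rewrite fct_sumE mulr_suml mxE; apply: eq_bigr => j _.
rewrite [_ (ucm t')](congr1 (GRing.scale (A i j)) (weight_series_ucm j t')).
by rewrite -[LHS]mulr1 -mulrA -[in RHS]mulrA; congr (_ * _); rewrite divfK ?mulr1.
Qed.

Local Notation K := (rk_character_stages E A).

Lemma character_stagesP :
  (forall i, tree_series (K i)) /\ forall i, K i =
    completed (ext E) (forest_exp (\sum_j A i j *: K j)) (Defs.fmonom R (ucm bullet)).
Proof.
apply: (@xgetPex _ (fun=> 0) [set K0 : 'I_s -> fseries |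
   (forall i, tree_series (K0 i)) /\ forall i, K0 i = completed (ext E)
     (forest_exp (\sum_j A i j *: K0 j)) (Defs.fmonom R (ucm bullet))]).
exists weight_series; split=> i; first exact: weight_series_tree.
exact: weight_series_stage.
Qed.

Lemma stage_pairing_Bplus w i :
  stage_pairing K (Bplus w) i 0
  = \prod_(t <- seq_of_forest w) (A *m stage_pairing K t) i 0.
Proof.
have [KT KE] := character_stagesP.
rewrite mxE pairing_ucm [K i]KE completed_bullet.
rewrite forest_expE; last exact: tree_series_sum.
rewrite tree_sym_Bplus tree_exp_sym; apply: eq_bigr => t _.
rewrite fct_sumE mulr_suml mxE; apply: eq_bigr => j _.
by rewrite mxE pairing_ucm mulrA.
Qed.

Lemma stage_pairing_weight (t : ptree) :
  stage_pairing K (mktree t) = stage_weight A t.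
Proof.
elim/ptree_seq_ind: t => l IH; apply/colP => i.
rewrite mktree_node stage_pairing_Bplus (perm_big _ (forest_ofK _)) big_map /=.
rewrite -/(stage_weight A (PNode l)) stage_weight_node.
by rewrite big_seq [RHS]big_seq; apply: eq_bigr => t /IH ->.
Qed.

Lemma character_pairing (b : 'rV[R]_s) t : pairing (rk_character E A b) (ucm t)
  = (b *m stage_pairing K t) 0 0.
Proof.
have [KT _] := character_stagesP.
rewrite pairing_ucm [rk_character E A b _]forest_expE; last exact: tree_series_sum.
rewrite tree_exp_ucm fct_sumE mulr_suml mxE; apply: eq_bigr => j _.
by rewrite mxE pairing_ucm mulrA.
Qed.

End CharacterStages.

Theorem theorem4p10 (R : realType) (s : nat) (A : 'M[R]_s) (b : 'rV[R]_s)
    (p : nat) (hp : (1 <= p)%N) (E : enveloping (@graft R) (@forest_iota R)) :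
  let K := rk_character_stages E A in
  let Psi := rk_character E A b in
  [/\ forall t : tree, pairing Psi (ucm t) = (b *m stage_pairing K t) 0 0,
      stage_pairing K bullet = const_mx 1,
      forall ts : seq tree, stage_pairing K (Bplus (forest_of ts)) =
        \big[@cmul R s / const_mx 1]_(t <- ts) (A *m stage_pairing K t)
    & (forall t : tree, (tree_size t <= p)%N ->
         pairing Psi (ucm t) = ((tree_fact t)%:R)^-1) ->
      forall (L : lmodType R) (tri : {bilinear L -> L -> L}),
        prelie tri -> rk_order A b p tri].
Proof.
have recP (ts : seq tree) i :
    stage_pairing (rk_character_stages E A) (Bplus (forest_of ts)) i 0
    = \prod_(t <- ts) (A *m stage_pairing (rk_character_stages E A) t) i 0.
  by rewrite stage_pairing_Bplus (perm_big _ (forest_ofK ts)).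
move=> K Psi; split=> [t||ts|orderP L tri _].
- exact: character_pairing.
- have -> : bullet = Bplus (forest_of [::]) by rewrite /forest_of big_nil.
  by apply/colP => i; rewrite recP big_nil mxE.
- apply/colP => i; rewrite recP.
  elim: ts => [|t ts IH]; first by rewrite !big_nil mxE.
  by rewrite !big_cons IH [RHS]mxE.
- apply: rk_order_weights => t tp.
  rewrite -(stage_pairing_weight E) -character_pairing orderP.
    by rewrite /tree_fact ptree_fact_canon.
  by rewrite /tree_size ptree_size_canon.
Qed.
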